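(* Let $n_0 > 1$ and $\alpha > 1$ be real numbers. There does not exist an infinite family $(K_i)_{i \geq 1}$ of pairwise non-isomorphic number fields, with $K_i$ of degree $n_i = [K_i:\mathbf{Q}]$ and discriminant $\Delta_{K_i}$, such that for all $i \geq 1$ \[\frac{1}{n_0} \left(\frac{\log |\Delta_{K_i}|}{\log\log |\Delta_{K_i}|}\right)^\alpha \;\leq\; n_i \;\leq\; n_0 \left(\frac{\log |\Delta_{K_i}|}{\log\log |\Delta_{K_i}|}\right)^\alpha .\]
   Context: $\Delta_K$ denotes the absolute discriminant of the number field $K$ and $\log$ is the natural logarithm. The inequalities are considered for fields with $|\Delta_{K_i}| \geq 3$, so that $\log\log|\Delta_{K_i}|$ is defined and positive (this excludes only $K_i=\mathbf{Q}$). *)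

(* Defs.v *)
From HB Require Import structures.
From mathcomp Require Import all_boot all_order all_algebra all_field.
From mathcomp Require Import all_classical all_reals all_analysis.

Set Implicit Arguments.
Unset Strict Implicit.
Unset Printing Implicit Defensive.

Import Order.TTheory GRing.Theory Num.Theory.
Local Open Scope ring_scope.

(* A number field is a [K : fieldExtType rat], of degree [\dim {:K}] over Q. *)

Definition algebraic_integer (K : fieldExtType rat) (x : K) : Prop :=
  integralOver (intr : int -> K) x.

Definition integral_basis (K : fieldExtType rat)
    (b : (\dim {:K}).-tuple K) : Prop :=
  (forall i : 'I_(\dim {:K}), algebraic_integer (tnth b i)) /\
  (forall x : K, algebraic_integer x ->
     exists! c : 'rV[int]_(\dim {:K}), x = \sum_i tnth b i *~ c 0 i).

(* The trace of the Q-linear map [y |-> x * y]; [galTrace] would only be the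
   field trace for Galois extensions. *)
Definition field_trace (K : fieldExtType rat) (x : K) : rat :=
  \tr (passmx.mxof (vbasis {:K}) (vbasis {:K}) (amull x)).

Definition trace_matrix (K : fieldExtType rat)
    (b : (\dim {:K}).-tuple K) : 'M[rat]_(\dim {:K}) :=
  \matrix_(i, j) field_trace (tnth b i * tnth b j).

(* The default value of [xget] is never used, since every number field has an
   integral basis; [discriminantE] below shows that the choice of the basis is
   irrelevant. *)
Definition discriminant (K : fieldExtType rat) : rat :=
  \det (trace_matrix
    (xget [tuple 0 | i < \dim {:K}] [set b | integral_basis b]%classic)).

Definition field_isomorphic (K L : fieldExtType rat) : Prop :=
  exists f : {rmorphism K -> L}, bijective f.

Section DiscriminantE.
Variable K : fieldExtType rat.
Implicit Types b c : (\dim {:K}).-tuple K.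
Let n := \dim {:K}.

Fact field_trace_linear : linear (@field_trace K : K -> rat^o).
Proof. move=> a x y; rewrite /field_trace linearP passmx.mxof_linear.
by rewrite mxtraceD mxtraceZ. Qed.

HB.instance Definition _ := GRing.isSemilinear.Build rat K rat^o *:%R
  (@field_trace K) (GRing.semilinear_linear field_trace_linear).

Lemma integral_basis_change b c : integral_basis b -> integral_basis c ->
  exists M : 'M[int]_n, forall i : 'I_n, tnth b i = \sum_j tnth c j *~ M i j.
Proof.
move=> [b_int _] [_ c_gen].
have /choice[r rP] (i : 'I_n) : exists r : 'rV[int]_n,
  tnth b i = \sum_j tnth c j *~ r 0 j.
  by have [r [? _]] := c_gen _ (b_int i); exists r.
by exists (\matrix_i r i) => i; rewrite rP; apply: eq_bigr => j _; rewrite mxE.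
Qed.

Lemma integral_basis_inj b (u v : 'rV[int]_n) : integral_basis b ->
  \sum_i tnth b i *~ u 0 i = \sum_i tnth b i *~ v 0 i -> u = v.
Proof.
move=> [_ b_gen] uv.
have [w [w0 w_uniq]] : exists! w : 'rV[int]_n, 0 = \sum_i tnth b i *~ w 0 i.
  by apply: b_gen; exists 'X; rewrite ?monicX // map_polyX rootX.
have w_eq0 : w = 0.
  by apply: w_uniq; rewrite big1 // => i _; rewrite mxE mulr0z.
suff : w = u - v by rewrite w_eq0 => /esym/eqP; rewrite subr_eq0 => /eqP.
apply: w_uniq; apply/esym.
under eq_bigr do rewrite !mxE mulrzBr.
by rewrite sumrB uv subrr.
Qed.

Lemma trace_matrix_change b c (M : 'M[int]_n) :
  (forall i : 'I_n, tnth b i = \sum_j tnth c j *~ M i j) ->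
  trace_matrix b = map_mx intr M *m trace_matrix c *m (map_mx intr M)^T.
Proof.
move=> bM; apply/matrixP => i j; rewrite !mxE !bM mulr_suml raddf_sum /=.
under [RHS]eq_bigr do rewrite !mxE mulr_suml.
rewrite [RHS]exchange_big /=; apply: eq_bigr => k _.
rewrite mulr_sumr raddf_sum /=; apply: eq_bigr => l _.
rewrite mulrzAl mulrzAr !raddfMz !mxE /=.
by rewrite -[LHS]mulrzl -[_ *~ M j l in LHS](mulrzr (field_trace _)) mulrA.
Qed.

Lemma discriminantE b :
  integral_basis b -> discriminant K = \det (trace_matrix b).
Proof.
move=> bP; rewrite /discriminant; set c := xget _ _.
have cP : integral_basis c.
  by apply: (@xgetPex _ _ [set b | integral_basis b]%classic); exists b.
have [M cM] := integral_basis_change cP bP.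
have [N bN] := integral_basis_change bP cP.
have MN1 : M *m N = 1%:M.
  apply/row_matrixP => i; apply: (integral_basis_inj cP).
  transitivity (tnth c i).
    rewrite cM; under [in RHS]eq_bigr do rewrite bN mulrz_suml.
    rewrite [RHS]exchange_big /=; apply: eq_bigr => j _.
    rewrite !mxE mulrz_sumr; apply: eq_bigr => k _.
    by rewrite -mulrzA mulrC.
  rewrite (bigD1 i) //= !mxE eqxx big1 ?addr0 // => j ji.
  by rewrite !mxE eq_sym (negPf ji).
have detM2 : (\det M) ^+ 2 = 1.
  have : \det M * \det N = 1 by rewrite -det_mulmx MN1 det1.
  by rewrite mulrC => /intUnitRing.unitzPl/orP[] /eqP ->; rewrite ?sqrrN expr1n.
rewrite (trace_matrix_change cM) !det_mulmx det_tr mulrAC -expr2.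
by rewrite det_map_mx -rmorphXn detM2 rmorph1 mul1r.
Qed.

End DiscriminantE.

(* Main.v *)
(** Let [n] and [D] be the degree and the discriminant of a number field.  The
    first inequality of the theorem bounds [n] below by a power [> 1] of
    [log |D|] up to logarithms, so the family has bounded degree and
    discriminant as soon as [log |D| >= c n - c'] for some [c > 0]; Hermite's
    theorem then gives two isomorphic members.

    Both the lower bound for [|D|] and Hermite's theorem come from one
    pigeonhole principle: a real lattice of covolume [V] has more than [k]
    points in some translate of a box of volume [> k V].  It is obtained by
    rounding the lattice to an integral one, whose index is its determinant.

    - Lower bound.  If [|D|] is less than [(6/5)^(2n) / 49], 8 distinct integers
      of [K] have all their conjugates within [2/3] of common centers.  The
      product of the norms of their differences is at least 1, but it is a
      product of [n] Vandermonde determinants, each at most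
      [8! (2/3)^28 < 1].
    - Hermite.  In a box that is long in one direction and short in all others
      there is a nonzero integer of [K]; as its norm is at least 1, one of its
      conjugates differs from all the others, hence it generates [K], and its
      characteristic polynomial has bounded integer coefficients. *)
From HB Require Import structures.
Require Import Defs.
From mathcomp Require Import all_boot all_order all_algebra all_field perm.
From mathcomp Require Import all_classical all_reals all_analysis.
From mathcomp Require Import complex ring lra.

Set Implicit Arguments.
Unset Strict Implicit.
Unset Printing Implicit Defensive.

Import Order.TTheory GRing.Theory Num.Theory.
Import numFieldNormedType.Exports.
Local Open Scope ring_scope.

(** * Generators and embeddings of a number field *)

Section Generators.
Variable K : fieldExtType rat.
Local Notation ratK := (GRing.in_alg K : {rmorphism rat -> K}).

(** The minimal polynomial is kept over [rat], so that generators of different fields can share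
    it. *)
Definition generates (x : K) (p : {poly rat}) :=
  map_poly ratK p = minPoly 1 x /\ <<1; x>>%VS = fullv :> {vspace K}.

Lemma generates_horner x p (y : K) :
  generates x p -> exists q : {poly rat}, y = (map_poly ratK q).[x].
Proof.
move=> [_ x_gen].
have /polyOver1P[q Dq] : Fadjoin_poly 1%AS x y \is a polyOver 1%VS.
  exact: Fadjoin_polyOver.
by exists q; rewrite -Dq Fadjoin_poly_eq // x_gen memvf.
Qed.

Lemma generates_dvdp x p (q : {poly rat}) :
  generates x p -> root (map_poly ratK q) x -> p %| q.
Proof.
move=> [Dp _] qx0; rewrite -(dvdp_map ratK) Dp; apply: minPoly_dvdp => //.
by apply/polyOver1P; exists q.
Qed.

(** Sending q(x) to q(z) is well defined: two polynomials with the same value at [x] differ by a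
    multiple of [p], which vanishes at [z]. *)
Lemma generates_morph x p (F : fieldType) (iota : {rmorphism rat -> F}) (z : F) :
  generates x p -> root (map_poly iota p) z ->
  exists f : {rmorphism K -> F}, f x = z.
Proof.
move=> xp pz0.
have /choice[q qP] y : exists q : {poly rat}, y = (map_poly ratK q).[x].
  exact: generates_horner xp.
pose f y := (map_poly iota (q y)).[z].
have f_horner r : f (map_poly ratK r).[x] = (map_poly iota r).[z].
  rewrite /f; set y := _.[x].
  have : p %| q y - r.
    apply: (generates_dvdp xp).
    by rewrite /root rmorphB /= hornerD hornerN -qP subrr.
  rewrite -(dvdp_map iota) => /dvdpP[s Ds].
  apply/eqP; rewrite -subr_eq0 -hornerN -hornerD -rmorphB /= Ds hornerM.
  by rewrite (rootP pz0) mulr0.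
have fB : additive f.
  move=> u v; rewrite {1}(qP u) {1}(qP v) -hornerN -hornerD -rmorphB f_horner.
  by rewrite rmorphB hornerD hornerN.
have fM : monoid_morphism f.
  split=> [|u v]; last first.
    by rewrite {1}(qP u) {1}(qP v) -hornerM -rmorphM f_horner rmorphM hornerM.
  by have := f_horner 1; rewrite !rmorph1 !hornerC.
pose fA := GRing.isZmodMorphism.Build _ _ f fB.
pose fR := GRing.isMonoidMorphism.Build _ _ f fM.
pose g : {rmorphism K -> F} := HB.pack f fA fR.
exists g; have := f_horner 'X; rewrite !map_polyX !hornerX; exact.
Qed.

Lemma generates_eq x p (F : fieldType) (f g : {rmorphism K -> F}) :
  generates x p -> f x = g x -> f =1 g.
Proof.
move=> xp fgx y; have [q ->] := generates_horner y xp.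
rewrite -!horner_map -!map_poly_comp fgx /=; congr (_.[_]).
apply: eq_map_poly => a /=.
by rewrite -[LHS]/((f \o ratK) a) -[RHS]/((g \o ratK) a) !fmorph_eq_rat.
Qed.

Lemma generates_root x p (F : fieldType) (f : {rmorphism K -> F})
    (iota : {rmorphism rat -> F}) :
  generates x p -> root (map_poly iota p) (f x).
Proof.
move=> [Dp _]; have -> : map_poly iota p = map_poly f (map_poly ratK p).
  rewrite -map_poly_comp; apply: eq_map_poly => a /=.
  by rewrite -[RHS]/((f \o ratK) a) !fmorph_eq_rat.
by rewrite fmorph_root Dp root_minPoly.
Qed.

Lemma generates_size x p : generates x p -> size p = (\dim {:K}).+1.
Proof.
move=> [Dp Dx]; rewrite -(size_map_poly ratK) Dp size_minPoly.
by rewrite adjoin_degreeE Dx dimv1 divn1.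
Qed.

Lemma generator_exists : exists x p, generates x p.
Proof.
have sepK : separable 1%AS {:K}%AS.
  apply/separableP => y _; apply: pcharf0_separable.
  by move=> q; rewrite (fmorph_pchar ratK) pchar_num.
have Dx := eq_adjoin_separable_generator sepK (sub1v _).
set x := separable_generator _ _ in Dx.
have /polyOver1P[p Dp] : minPoly 1%AS x \is a polyOver 1%VS by apply: minPolyOver.
by exists x, p; split.
Qed.

(** The embeddings correspond to the roots of the minimal polynomial of a primitive element, which
    are simple in characteristic 0; that element separates them. *)
Lemma embeddings_exist (C : numClosedFieldType) :
  exists s : 'I_(\dim {:K}) -> {rmorphism K -> C},
    (exists x, injective (fun j => s j x)) /\
    (forall f : {rmorphism K -> C}, exists j, f =1 s j).
Proof.
have [x [p xp]] := generator_exists.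
pose iota : {rmorphism rat -> C} := ratr.
have p_monic : p \is monic by rewrite -(map_monic ratK) xp.1 monic_minPoly.
have [r Dr] := closed_field_poly_normal (map_poly iota p).
rewrite (monicP _) ?monic_map // scale1r in Dr.
have r_uniq : uniq r.
  rewrite -separable_prod_XsubC -Dr separable_map -(separable_map ratK) xp.1.
  have : separable_element 1%AS x; last by [].
  by apply: pcharf0_separable => q; rewrite (fmorph_pchar ratK) pchar_num.
have r_size : size r = \dim {:K}.
  apply: succn_inj; rewrite -(generates_size xp) -(size_map_poly iota) Dr.
  by rewrite size_prod_XsubC.
have /choice[s sP] (j : 'I_(\dim {:K})) : exists f : {rmorphism K -> C}, f x = r`_j.
  apply: (generates_morph (iota := iota) xp).
  by rewrite Dr root_prod_XsubC mem_nth // r_size.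
exists s; split=> [|f].
  exists x => i j; rewrite !sP => /eqP.
  by rewrite nth_uniq ?r_size // => /eqP/ord_inj.
have : root (map_poly iota p) (f x) by apply: generates_root xp.
rewrite Dr root_prod_XsubC => /(nthP 0)[j]; rewrite r_size => ltj fx.
by exists (Ordinal ltj); apply: (generates_eq xp); rewrite sP.
Qed.

End Generators.

Section Embeddings.
Variables (K : fieldExtType rat) (C : numClosedFieldType).
Let n := \dim {:K}.
Variable s : 'I_n -> {rmorphism K -> C}.
Hypothesis s_sep : exists x, injective (fun j => s j x).

Lemma embeddingZ (f : {rmorphism K -> C}) a y : f (a *: y) = ratr a * f y.
Proof.
rewrite -mulr_algl rmorphM; congr (_ * _).
by rewrite -[LHS]/((f \o GRing.in_alg K) a) fmorph_eq_rat.
Qed.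

(** The Vandermonde matrix of the conjugates of a separating element factors through this matrix. *)
Lemma embedding_mx_unit : \matrix_(i, j) s j (vbasis {:K})`_i \in unitmx.
Proof.
have [x x_inj] := s_sep.
pose c := \matrix_(k < n, i < n) coord (vbasis {:K}) i (x ^+ k).
have : Vandermonde n (\row_j s j x) =
    map_mx ratr c *m \matrix_(i, j) s j (vbasis {:K})`_i.
  apply/matrixP => k j; rewrite !mxE -rmorphXn.
  rewrite [X in s j X](coord_basis (vbasisP _) (memvf _)) rmorph_sum.
  by apply: eq_bigr => i _; rewrite embeddingZ !mxE.
move/(congr1 determinant); rewrite det_Vandermonde det_mulmx unitmxE unitfE => Dc.
apply: contra_eq_neq Dc => ->; rewrite mulr0; apply/prodf_neq0 => i _.
apply/prodf_neq0 => j ltij; rewrite !mxE subr_eq0.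
by apply: contraTneq ltij => /x_inj ->; rewrite ltnn.
Qed.

Definition mult_mx (x : K) : 'M[rat]_n :=
  passmx.mxof (vbasis {:K}) (vbasis {:K}) (amull x).

Lemma mult_mx_diag x :
  let V := \matrix_(i, j) s j (vbasis {:K})`_i in
  map_mx ratr (mult_mx x) *m V = V *m diag_mx (\row_j s j x).
Proof.
apply/matrixP => i j; rewrite mul_mx_diag !mxE -rmorphM mulrC.
rewrite [X in _ = s j X](coord_basis (vbasisP _) (memvf _)) rmorph_sum.
apply: eq_bigr => k _; rewrite embeddingZ !mxE /=.
by rewrite passmx.vecof_delta lfunE.
Qed.

Lemma char_poly_mult_mx x :
  map_poly ratr (char_poly (mult_mx x)) = \prod_j ('X - (s j x)%:P).
Proof.
have := embedding_mx_unit; set V := \matrix_(i, j) _ => V_unit.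
have Dx : map_mx ratr (mult_mx x) *m V = V *m diag_mx (\row_j s j x).
  exact: mult_mx_diag.
set D := diag_mx _ in Dx; set A := map_mx _ _ in Dx.
have AD : char_poly_mx A *m map_mx polyC V = map_mx polyC V *m char_poly_mx D.
  by rewrite mulmxBl mulmxBr scalar_mxC -!map_mxM Dx.
have : char_poly A = char_poly D.
  have := congr1 determinant AD; rewrite !det_mulmx mulrC; apply: mulfI.
  by rewrite det_map_mx polyC_eq0 -unitfE -unitmxE.
rewrite map_char_poly => ->; rewrite char_poly_trig ?diag_mx_is_trig //.
by apply: eq_bigr => j _; rewrite !mxE eqxx.
Qed.

Lemma field_trace_embeddings x :
  ratr (\tr (mult_mx x)) = \sum_j s j x.
Proof.
have := embedding_mx_unit; set V := \matrix_(i, j) _ => V_unit.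
have Dx : map_mx ratr (mult_mx x) *m V = V *m diag_mx (\row_j s j x).
  exact: mult_mx_diag.
rewrite -trace_map_mx -[map_mx _ _](mulmxK V_unit) Dx mxtrace_mulC mulKmx //.
by rewrite mxtrace_diag; apply: eq_bigr => j _; rewrite mxE.
Qed.

End Embeddings.

(** The coefficients are rational, and they are algebraic integers because the roots, which are
    conjugates of [x], are. *)
Lemma char_poly_mult_mx_int (K : fieldExtType rat) (x : K) :
  algebraic_integer x ->
  exists p : {poly int}, char_poly (mult_mx x) = map_poly intr p.
Proof.
move=> [p p_monic px0].
have [s [s_sep _]] := embeddings_exist K algC.
have s_Aint j : s j x \in Aint.
  apply: (@root_monic_Aint (map_poly intr p)); rewrite ?monic_map //; last first.
    by apply/polyOverP => i; rewrite coef_map /= intr_int.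
  move: px0; rewrite -(fmorph_root (s j)) -map_poly_comp.
  by congr (root _ _); apply: eq_map_poly => a /=; rewrite rmorph_int.
have chi_Aint : map_poly ratr (char_poly (mult_mx x)) \is a polyOver Aint.
  rewrite (char_poly_mult_mx s_sep); apply: rpred_prod => j _.
  by rewrite polyOverXsubC.
suff /floorpP[q Dq] : char_poly (mult_mx x) \is a polyOver Num.int by exists q.
apply/polyOverP => i; have := polyOverP chi_Aint i; rewrite coef_map /=.
set a := _`_i; move=> /(Cint_rat_Aint _) aP.
have /intrP[m Dm] : ratr a \is a @Num.int algC.
  by apply: aP; apply/CratP; exists a.
apply/intrP; exists m; apply: (fmorph_inj (ratr : {rmorphism rat -> algC})).
by rewrite /= Dm ratr_int.
Qed.

(** Up to sign the product is the constant term of the integral characteristic polynomial, hence a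
    nonzero integer. *)
Lemma norm_embeddings_ge1 (K : fieldExtType rat) (C : numClosedFieldType)
    (s : 'I_(\dim {:K}) -> {rmorphism K -> C}) (x : K) :
  (exists x, injective (fun j => s j x)) ->
  algebraic_integer x -> x != 0 -> 1 <= `|\prod_j s j x|.
Proof.
move=> s_sep /char_poly_mult_mx_int[p Dp] x_neq0.
have : 0 < `|\prod_j s j x|.
  by rewrite normr_gt0; apply/prodf_neq0 => j _; rewrite fmorph_eq0.
have -> : `|\prod_j s j x| = `|(p`_0)%:~R|.
  have := congr1 (fun q : {poly C} => q.[0]) (char_poly_mult_mx s_sep x).
  rewrite /= horner_coef0 coef_map /= Dp coef_map /= ratr_int => ->.
  rewrite horner_prod !normr_prod; apply: eq_bigr => j _.
  by rewrite hornerXsubC sub0r normrN.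
by rewrite -intr_norm ltr0z ler1z gtz0_ge1.
Qed.

(** If the minimal polynomial were a proper divisor of the characteristic polynomial, the cofactor
    [h] would vanish at some conjugate of [x], hence at all of them, and [s j0 x] would be a
    multiple root. *)
Lemma generates_char_poly (K : fieldExtType rat) (C : numClosedFieldType)
    (s : 'I_(\dim {:K}) -> {rmorphism K -> C}) (x : K) j0 :
  (exists x, injective (fun j => s j x)) ->
  (forall j, j != j0 -> s j x != s j0 x) ->
  generates x (char_poly (mult_mx x)).
Proof.
move=> s_sep x_sep; set chi := char_poly _.
pose ratK : {rmorphism rat -> K} := GRing.in_alg K.
pose iota : {rmorphism rat -> C} := ratr.
have Dchi : map_poly iota chi = \prod_j ('X - (s j x)%:P).
  exact: char_poly_mult_mx.
have rootE j (q : {poly rat}) :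
    root (map_poly iota q) (s j x) = root (map_poly ratK q) x.
  rewrite -(fmorph_root (s j)) -map_poly_comp; congr (root _ _).
  by apply: eq_map_poly => a; rewrite !fmorph_eq_rat.
have /polyOver1P[mu Dmu] : minPoly 1%AS x \is a polyOver 1%VS.
  exact: minPolyOver.
have mu_dvd q : root (map_poly ratK q) x -> mu %| q.
  move=> qx0; rewrite -(dvdp_map ratK) -[map_poly ratK mu]Dmu.
  apply: minPoly_dvdp => //.
  by apply/polyOver1P; exists q.
have chix0 : root (map_poly ratK chi) x.
  by rewrite -(rootE j0) Dchi (bigD1 j0) //= rootM root_XsubC eqxx.
have chi_monic : chi \is monic by apply: char_poly_monic.
have mu_monic : mu \is monic.
  by rewrite -(map_monic ratK) -[map_poly _ _]Dmu monic_minPoly.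
have [h Dh] := dvdpP _ _ (mu_dvd chi chix0).
have h_size : size h = 1%N.
  apply: contraTeq isT => h_size.
  have /closed_rootP[w hw0] : size (map_poly iota h) != 1%N by rewrite size_map_poly.
  have : root (map_poly iota chi) w by rewrite Dh rmorphM rootM hw0.
  rewrite Dchi -(big_map (fun j => s j x) xpredT (fun z => 'X - z%:P)).
  rewrite root_prod_XsubC.
  case/mapP => j _ Dw; rewrite Dw rootE in hw0.
  (* By the factorization the derivative at [s j0 x] is 0; by the product over the embeddings it is
     not, as [s j0 x] is a simple root. *)
  have := congr1 (fun q => q^`().[s j0 x]) Dchi.
  rewrite Dh rmorphM derivM hornerD !hornerM.
  have /rootP-> : root (map_poly iota h) (s j0 x) by rewrite rootE.
  have /rootP-> : root (map_poly iota mu) (s j0 x).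
    by rewrite rootE -[map_poly _ _]Dmu root_minPoly.
  rewrite mulr0 mul0r addr0 (bigD1 j0) //= derivM hornerD !hornerM derivXsubC.
  rewrite hornerXsubC subrr mul0r addr0 hornerC mul1r horner_prod => /esym/eqP.
  case/prodf_eq0 => i ij0; rewrite hornerXsubC subr_eq0 eq_sym.
  by rewrite (negPf (x_sep i ij0)).
have Dmuchi : mu = chi.
  apply/eqP; rewrite -eqp_monic // Dh.
  have /size_poly1P[c c0 ->] : size h == 1%N by rewrite h_size.
  by rewrite mul_polyC eqp_sym eqp_scale.
split; first by rewrite -Dmuchi -Dmu.
apply/eqP; rewrite eqEdim subvf /= dim_Fadjoin dimv1 muln1 -ltnS -size_minPoly.
by rewrite Dmu size_map_poly Dmuchi size_char_poly.
Qed.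

Lemma generates_isomorphic (K L : fieldExtType rat) (x : K) (y : L) p :
  generates x p -> generates y p -> exists f : {rmorphism K -> L}, bijective f.
Proof.
move=> xp yp.
pose ratL : {rmorphism rat -> L} := GRing.in_alg L.
pose ratK : {rmorphism rat -> K} := GRing.in_alg K.
have [f fx] : exists f : {rmorphism K -> L}, f x = y.
  apply: (generates_morph (iota := ratL) xp).
  by rewrite [map_poly _ _]yp.1 root_minPoly.
have [g gy] : exists g : {rmorphism L -> K}, g y = x.
  apply: (generates_morph (iota := ratK) yp).
  by rewrite [map_poly _ _]xp.1 root_minPoly.
exists f, g => z.
  apply: (generates_eq (f := g \o f : {rmorphism K -> K}) (g := idfun) xp).
  by rewrite /= fx.
apply: (generates_eq (f := f \o g : {rmorphism L -> L}) (g := idfun) yp).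
by rewrite /= gy.
Qed.

(** * The pigeonhole principle for lattices *)

Lemma pigeonhole_card (T U : finType) (f : T -> U) k :
  (k * #|U| < #|T|)%N -> exists u, exists t : 'I_k.+1 -> T,
    injective t /\ forall a, f (t a) = u.
Proof.
move=> ltkT.
have [u ltku] : exists u, (k < #|[pred x | f x == u]|)%N.
  apply: contrapT => /forallNP ubk; move: ltkT; rewrite ltnNge => /negP[].
  rewrite -sum1_card (partition_big f xpredT) //= mulnC -sum_nat_const.
  apply: leq_sum => u _; rewrite sum1_card leqNgt; exact/negP/ubk.
exists u, (fun a => enum_val (widen_ord ltku a)); split=> [a b|a].
  by move=> /enum_val_inj/(congr1 val) /= /ord_inj.
by have := enum_valP (widen_ord ltku a); rewrite inE => /eqP.
Qed.

(** The Smith form identifies the quotient of Z^n by the row lattice of [A] with a product of cyclic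
    groups of total order |det A|; points in a common class differ by lattice vectors. *)
Lemma int_lattice_pigeonhole (n k : nat) (A : 'M[int]_n) (T : finType)
    (x : T -> 'rV[int]_n) :
  \det A != 0 -> (k * `|\det A|%N < #|T|)%N ->
  exists (t0 : T) (t : 'I_k.+1 -> T) (v : 'I_k.+1 -> 'rV[int]_n),
    injective t /\ forall a, v a *m A = x (t a) - x t0.
Proof.
have [L L_unit [U U_unit [d _ DA]]] := int_Smith_normal_form A.
set D := \matrix_(i, j) _ in DA.
have det_unit (M : 'M[int]_n) : M \in unitmx -> `|\det M|%N = 1%N.
  by rewrite unitmxE => /orP[] /eqP->.
have DdetA : `|\det A|%N = (\prod_(i < n) `|(d`_i)%R|)%N.
  rewrite DA !det_mulmx !abszM (det_unit L) // (det_unit U) // mul1n muln1.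
  rewrite det_trig; last first.
    by apply/is_trig_mxP => i j ij; rewrite mxE (ltn_eqF ij).
  rewrite (big_morph absz abszM absz1); apply: eq_bigr => i _.
  by rewrite mxE eqxx.
move=> detA_neq0 ltkT.
have d_neq0 (i : 'I_n) : d`_i != 0.
  rewrite -absz_eq0; apply: contraNneq detA_neq0 => di0.
  by rewrite -absz_eq0 DdetA (bigD1 i) //= di0.
have modP (i : 'I_n) m : (`|(m %% d`_i)%Z| < `|(d`_i)%R|)%N.
  by rewrite -ltz_nat gez0_abs ?modz_ge0 // ltz_mod.
(* [phi z] is the class of [x z]: its coordinates in the basis [U], reduced modulo the invariant
   factors. *)
pose phi (z : T) : {dffun forall i : 'I_n, 'I_(`|(d`_i)%R|)} :=
  [ffun i => Ordinal (modP i ((x z *m invmx U) 0 i))].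
have [|u [t [t_inj tP]]] := @pigeonhole_card _ _ phi k.
  rewrite card_dep_ffun foldrE big_map big_enum /=.
  by under eq_bigr do rewrite card_ord; rewrite -DdetA.
pose y := x (t ord0).
pose w a := \row_i divz (((x (t a) - y) *m invmx U) 0 i) d`_i.
exists (t ord0), t, (fun a => w a *m invmx L); split=> // a.
rewrite DA !mulmxA mulmxKV // -/y.
suff -> : w a *m D = (x (t a) - y) *m invmx U by rewrite mulmxKV.
apply/rowP => i; rewrite [LHS]mxE (bigD1 i) //= [D i i]mxE eqxx mulr1n.
rewrite big1 ?addr0 => [|j ji]; last first.
  rewrite [D j i]mxE -[_ == _ :> nat]/(j == i) (negPf ji).
  by rewrite mulr0n mulr0.
rewrite [w a 0 i]mxE divzK // mulmxBl [(_ - _ : 'rV_n) 0 i]mxE.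
rewrite [(- _ : 'rV_n) 0 i]mxE -eqz_mod_dvd; apply/eqP.
have /(congr1 val) : phi (t a) i = phi (t ord0) i by rewrite !tP.
by rewrite !ffunE /= => /(congr1 Posz); rewrite !gez0_abs ?modz_ge0.
Qed.

Section Blichfeldt.
Variable R : realType.
Local Open Scope classical_set_scope.

Lemma cvg_det n (A : nat -> 'M[R]_n) (B : 'M[R]_n) :
  (forall i j, A m i j @[m --> \oo] --> B i j) ->
  \det (A m) @[m --> \oo] --> \det B.
Proof.
move=> AB; rewrite /determinant.
have cvgP (r : seq 'I_n) (f : 'I_n -> 'I_n) :
    \prod_(i <- r) A m i (f i) @[m --> \oo] --> \prod_(i <- r) B i (f i).
  elim: r => [|i r IHr].
    by rewrite big_nil; under eq_cvg do rewrite big_nil; exact: cvg_cst.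
  by rewrite big_cons; under eq_cvg do rewrite big_cons; exact: cvgM.
elim: (index_enum _) => [|f r IHr].
  by rewrite big_nil; under eq_cvg do rewrite big_nil; exact: cvg_cst.
rewrite big_cons; under eq_cvg do rewrite big_cons.
by apply: cvgD => //; apply: cvgM => //; exact: cvg_cst.
Qed.

Definition floor_mx n (B : 'M[R]_n) (m : nat) : 'M[int]_n :=
  \matrix_(i, j) Num.floor (m%:R * B i j).

Definition rounded_mx n (B : 'M[R]_n) (m : nat) : 'M[R]_n :=
  m%:R^-1 *: map_mx intr (floor_mx B m).

Lemma rounded_mx_dist n m (B : 'M[R]_n) i j :
  (0 < m)%N -> `|B i j - rounded_mx B m i j| <= m%:R^-1.
Proof.
move=> m_gt0; have mR_gt0 : 0 < m%:R :> R by rewrite ltr0n.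
rewrite !mxE -[X in `|X - _|](mulKf (lt0r_neq0 mR_gt0)) -mulrBr normrM.
rewrite gtr0_norm ?invr_gt0 // ler_piMr ?invr_ge0 //.
have /andP[f1 f2] := floor_itv (m%:R * B i j).
rewrite ger0_norm ?subr_ge0 // lerBlDl.
by rewrite intrD in f2; apply: ltW.
Qed.

Lemma det_rounded_mx_cvg n (B : 'M[R]_n) :
  \det (rounded_mx B m) @[m --> \oo] --> \det B.
Proof.
apply: cvg_det => i j.
apply/cvgrPdist_le => e e0; near=> m.
have m_gt0 : (0 < m)%N by near: m; exact: nbhs_infty_gt.
apply: le_trans (rounded_mx_dist B i j m_gt0) _.
rewrite invf_ple ?posrE ?ltr0n //.
by near: m; exact: nbhs_infty_ger.
Unshelve. all: by end_near. Qed.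

(** The integral principle is applied to the rounding of m B and to the m^n grid points of a cube of
    side m; dividing by m gives a unit cube, and the excess of [rho] over 1 absorbs the rounding
    error. *)
Lemma real_lattice_pigeonhole n k (B : 'M[R]_n) (rho : R) :
  \det B != 0 -> k%:R * `|\det B| < 1 -> 1 < rho ->
  exists (t : 'rV[R]_n) (v : 'I_k.+1 -> 'rV[int]_n), injective v /\
    forall a j, `|(map_mx intr (v a) *m B) 0 j - t 0 j| <= rho / 2.
Proof.
move=> detB_neq0 kB rho1.
pose A' := rounded_mx B.
have A'_cvg : \det (A' m) @[m --> \oo] --> \det B by exact: det_rounded_mx_cvg.
pose c := \sum_i \sum_j `|invmx B j i|.
(* The last bound on [m] yields [N <= 2 * c] below, and then [N / m%:R <= (rho - 1) / 2]. *)
have [m [m_gt0 detA_neq0 kA cm]] : exists m : nat,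
   [/\ (0 < m)%N, \det (A' m) != 0, k%:R * `|\det (A' m)| < 1
     & 4 * c / (rho - 1) + 2 * c <= m%:R].
  have : \forall m \near \oo, [/\ (0 < m)%N, \det (A' m) != 0,
     k%:R * `|\det (A' m)| < 1 & 4 * c / (rho - 1) + 2 * c <= m%:R].
    near=> m; split.
    - by near: m; exact: nbhs_infty_gt.
    - by near: m; exact: cvgr_neq0 A'_cvg detB_neq0.
    - near: m; apply: (cvgr_lt (k%:R * `|\det B|)) => //.
      by apply: cvgM; [exact: cvg_cst|exact: cvg_norm].
    - by near: m; exact: nbhs_infty_ger.
  by move=> /filter_ex[m mP]; exists m.
have mR_gt0 : 0 < m%:R :> R by rewrite ltr0n.
pose A := floor_mx B m.
have detA' : \det (A' m) = m%:R^-1 ^+ n * (\det A)%:~R.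
  by rewrite detZ det_map_mx.
pose box (z : {ffun 'I_n -> 'I_m}) : 'rV[int]_n := \row_i (z i : nat)%:Z.
have [||t0 [t [v [t_inj vP]]]] := @int_lattice_pigeonhole n k A _ box.
- by apply: contraNneq detA_neq0 => detA0; rewrite detA' detA0 mulr0.
- rewrite card_ffun !card_ord -(ltr_nat R) natrM natrX.
  move: kA; rewrite detA' normrM normrX ger0_norm ?invr_ge0 ?ler0n // exprVn.
  rewrite mulrCA.
  rewrite mulrC ltr_pdivrMr ?exprn_gt0 // mul1r.
  by rewrite natr_absz intr_norm.
(* Grid coordinates divided by m lie in [0, 1]; subtracting those of [t0] leaves an interval of
   length 1 with this center. *)
exists (\row_j (2^-1 - (t0 j)%:R / m%:R)), v; split.
  move=> a b vab; apply: t_inj; apply/ffunP => i; apply/val_inj/eqP.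
  rewrite -eqz_nat; apply/eqP.
  have : box (t a) - box t0 = box (t b) - box t0 by rewrite -!vP vab.
  by move/addIr/rowP/(_ i); rewrite !mxE.
move=> a j; set V : 'rV[R]_n := map_mx intr (v a).
have w_eq i : (V *m A' m) 0 i = (t a i)%:R / m%:R - (t0 i)%:R / m%:R.
  by rewrite -scalemxAr -map_mxM vP !mxE rmorphB /= mulrC mulrBl.
(* [V] is bounded independently of [m], since [V A'] is and [A'] is close to
   the invertible [B]; so the rounding error [V E] tends to 0. *)
pose E := B - A' m.
have E_le i l : `|E i l| <= m%:R^-1.
  by have := rounded_mx_dist B i l m_gt0; rewrite !mxE.
pose N := \sum_i `|V 0 i|.
have N_ge0 : 0 <= N by apply: sumr_ge0.
have VE_le l : `|(V *m E) 0 l| <= N / m%:R.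
  rewrite mxE mulr_suml; apply: le_trans (ler_norm_sum _ _ _) _.
  by apply: ler_sum => i _; rewrite normrM ler_wpM2l.
have VB : V *m B = V *m A' m + V *m E by rewrite -mulmxDr addrC subrK.
have frac_itv (z : 'I_m) : 0 <= (z%:R / m%:R : R) <= 1.
  by rewrite divr_ge0 ?ler0n // ler_pdivrMr // mul1r ler_nat ltnW.
have c_ge0 : 0 <= c by apply: sumr_ge0 => i _; apply: sumr_ge0.
have DV : V = V *m B *m invmx B by rewrite mulmxK // unitmxE unitfE.
have N_le : N <= (1 + N / m%:R) * c.
  rewrite /N /c mulr_sumr; apply: ler_sum => i _.
  rewrite {1}DV mxE mulr_sumr.
  apply: le_trans (ler_norm_sum _ _ _) _; apply: ler_sum => l _.
  rewrite normrM ler_wpM2r // VB mxE; apply: le_trans (ler_normD _ _) _.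
  rewrite lerD ?VE_le // w_eq ler_norml.
  have := frac_itv (t a l); have := frac_itv (t0 l).
  by lra.
have c_le1 : 0 <= 4 * c / (rho - 1).
  by rewrite divr_ge0 ?mulr_ge0 ?ler0n // subr_ge0 ltW.
have {}N_le : N <= 2 * c.
  have : N / m%:R * c <= N / 2.
    rewrite mulrAC -mulrA ler_wpM2l // ler_pdivrMr //.
    by rewrite mulrC ler_pdivlMr ?ltr0n //; lra.
  by lra.
have NM_le : N / m%:R <= (rho - 1) / 2.
  rewrite ler_pdivrMr //.
  have : 4 * c / (rho - 1) <= m%:R by lra.
  by rewrite ler_pdivrMr ?subr_gt0 //; lra.
have := le_trans (VE_le j) NM_le; rewrite ler_norml => /andP[e1 e2].
rewrite VB [X in `|X - _|]mxE w_eq [X in `|_ - X|]mxE.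
have /andP[f1 f2] := frac_itv (t a j); rewrite ler_norml; apply/andP; split; lra.
Unshelve. all: by end_near. Qed.
End Blichfeldt.

(** * The lattice of integers *)

(* [z |-> (hartley z, hartley (conjc z))] is an isometry up to the factor
   [sqrt 2], and [hartley] is the identity on real numbers: taking [hartley] of
   all the conjugates gives real coordinates in which real and complex places
   need not be told apart. *)
Definition hartley (R : realType) (z : R[i]) : R := complex.Re z + complex.Im z.

Lemma hartley_is_zmod_morphism (R : realType) : zmod_morphism (@hartley R).
Proof. by move=> [x y] [x' y']; rewrite /hartley /= opprD addrACA. Qed.

HB.instance Definition _ (R : realType) :=
  GRing.isZmodMorphism.Build R[i] R (@hartley R) (@hartley_is_zmod_morphism R).

(** With p = [hartley z - a] and q = [hartley (conjc z) - b], the squared distance is (p^2 + q^2) /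
    2. *)
Lemma norm_le_hartley (R : realType) (z : R[i]) (a b r : R) :
  `|hartley z - a| <= r -> `|hartley (conjc z) - b| <= r ->
  `|z - ((a + b) / 2 +i* ((a - b) / 2))%C| <= r%:C%C.
Proof.
case: z => x y; rewrite /hartley /= => ha hb.
have r_ge0 : 0 <= r by apply: le_trans ha.
rewrite normc_def lecR /= -(ler_pXn2r (n := 2)) ?nnegrE ?sqrtr_ge0 //.
rewrite sqr_sqrtr ?addr_ge0 ?sqr_ge0 //.
have sqr_le (p : R) : `|p| <= r -> p ^+ 2 <= r ^+ 2.
  by move=> pr; rewrite -[p ^+ 2]real_normK ?num_real // lerXn2r ?nnegrE.
by have := sqr_le _ ha; have := sqr_le _ hb; lra.
Qed.

Section RealLattice.
Variables (R : realType) (K : fieldExtType rat).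
Let n := \dim {:K}.
Variable s : 'I_n -> {rmorphism K -> R[i]}.
Hypothesis s_sep : exists x, injective (fun j => s j x).
Hypothesis s_full : forall f : {rmorphism K -> R[i]}, exists j, f =1 s j.
Variable b : n.-tuple K.

Lemma det_trace_matrix :
  ratr (\det (trace_matrix b)) = (\det (\matrix_(i, j) s j (tnth b i))) ^+ 2.
Proof.
rewrite expr2 -[X in _ * X]det_tr -det_mulmx -det_map_mx; congr (\det _).
apply/matrixP => i j; rewrite !mxE [LHS](field_trace_embeddings s_sep).
by apply: eq_bigr => k _; rewrite !mxE rmorphM.
Qed.

Lemma conj_index_exists :
  exists2 c : 'I_n -> 'I_n, involutive c & forall j x, s (c j) x = conjc (s j x).
Proof.
have /choice[c cP] j : exists i, forall x, conjc (s j x) = s i x.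
  have [i si] := s_full ((@conjc R : {rmorphism R[i] -> R[i]}) \o s j).
  by exists i => x; rewrite -si.
have [x x_inj] := s_sep.
exists c => [j|j y]; last by rewrite cP.
by apply: x_inj; rewrite -!cP conjcK.
Qed.

Definition lattice_mx : 'M[R]_n := \matrix_(i, j) hartley (s j (tnth b i)).

Definition int_comb (v : 'rV[int]_n) : K := \sum_i tnth b i *~ v 0 i.

Lemma lattice_mxE v j :
  (map_mx intr v *m lattice_mx) 0 j = hartley (s j (int_comb v)).
Proof.
rewrite mxE /int_comb !raddf_sum; apply: eq_bigr => i _.
by rewrite !mxE !raddfMz mulrzl.
Qed.

Lemma sqr_det_lattice_mx : (\det lattice_mx) ^+ 2 = ratr `|\det (trace_matrix b)|.
Proof.
have [c cK cP] := conj_index_exists.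
(* [z |-> hartley z] is [u z + conj (u z)], hence the real lattice matrix is the
   matrix of conjugates times the unitary matrix [P u]. *)
pose Q : 'M[R[i]]_n := \matrix_(i, j) (i == c j)%:R.
pose P (u : R[i]) : 'M[R[i]]_n := u%:M + (conjc u) *: Q.
pose u : R[i] := Complex (2^-1) (- 2^-1).
have QM (A : 'M[R[i]]_n) i j : (A *m Q) i j = A i (c j).
  rewrite mxE (bigD1 (c j)) //= mxE eqxx mulr1 big1 ?addr0 // => k kc.
  by rewrite mxE (negPf kc) mulr0.
have QQ : Q *m Q = 1%:M by apply/matrixP => i j; rewrite QM !mxE cK.
(* As [u] is (1 - i) / 2, u^2 plus its conjugate is 0 and 2 |u|^2 = 1; [Q] squares to 1 because [c]
   is an involution. *)
have PP : P u *m P (conjc u) = 1%:M.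
  rewrite /P conjcK mulmxDl !mulmxDr -!scalemxAl -!scalemxAr QQ.
  rewrite !mul_scalar_mx mul_mx_scalar -[(conjc u)%:M]scalemx1 !scalerA.
  rewrite [X in _ + X]addrC addrACA -!scalerDl.
  have -> : u * u + conjc u * conjc u = 0.
    by apply/eqP; rewrite eq_complex /=; apply/andP; split; apply/eqP; field.
  rewrite scale0r addr0 -[RHS]scale1r; congr (_ *: _).
  by apply/eqP; rewrite eq_complex /=; apply/andP; split; apply/eqP; field.
set A := \matrix_(i, j) s j (tnth b i).
have BA : map_mx (real_complex R) lattice_mx = A *m P u.
  apply/matrixP => i j; rewrite mulmxDr [RHS]mxE mul_mx_scalar -scalemxAr.
  rewrite [X in _ = _ + X]mxE QM !mxE cP; case: (s j _) => x y.
  apply/eqP; rewrite eq_complex /=.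
  by apply/andP; split; apply/eqP; rewrite /hartley /=; field.
have normP : `|\det (P u)| = 1.
  have := congr1 (fun M => `|\det M|) PP; rewrite /= det_mulmx det1 normr1 normrM.
  have -> : P (conjc u) = map_mx (@conjc R) (P u).
    apply/matrixP => i j; rewrite !mxE rmorphD rmorphM rmorphMn /=.
    by case: (i == c j); rewrite ?rmorph1 ?rmorph0.
  rewrite det_map_mx.
  have -> : `|conjc (\det (P u))| = `|\det (P u)|.
    by case: (\det _) => x y; rewrite !normc_def /= sqrrN.
  by rewrite -expr2 => /eqP; rewrite sqrp_eq1 // => /eqP.
apply: (@complexI R).
have -> : real_complex R (ratr `|\det (trace_matrix b)|) =
    `|ratr (\det (trace_matrix b))|.
  by rewrite -ratr_norm (fmorph_rat (real_complex R)).
rewrite det_trace_matrix -/A normrX.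
rewrite -[\det lattice_mx ^+ 2]ger0_norm ?sqr_ge0 //.
have normC (x : R) : (`|x|)%:C%C = `|x%:C%C|.
  by rewrite normc_def /= expr0n addr0 sqrtr_sqr.
by rewrite normC rmorphXn /= normrX -det_map_mx BA det_mulmx normrM normP mulr1.
Qed.
End RealLattice.

(** * Lower bound for the discriminant *)

(** The product is the absolute value of a Vandermonde determinant, unchanged when all points are
    shifted by [c]; each of its m! terms is at most r^(0 + 1 + ... + (m - 1)). *)
Lemma prod_dist_le (C : numFieldType) m (z : 'I_m -> C) (c r : C) :
  (forall a, `|z a - c| <= r) ->
  \prod_(a < m) \prod_(a' < m | (a < a')%N) `|z a' - z a| <= m`!%:R * r ^+ 'C(m, 2).
Proof.
move=> zr.
pose V := Vandermonde m (\row_a (z a - c)).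
have -> : \prod_(a < m) \prod_(a' < m | (a < a')%N) `|z a' - z a| = `|\det V|.
  rewrite det_Vandermonde normr_prod; apply: eq_bigr => a _.
  rewrite normr_prod; apply: eq_bigr => a' _; rewrite !mxE.
  by rewrite opprB addrA subrK.
apply: le_trans (ler_norm_sum _ _ _) _.
have -> : m`!%:R * r ^+ 'C(m, 2) = \sum_(p : 'S_m) r ^+ 'C(m, 2).
  by rewrite sumr_const mulr_natl -card_Sn; congr (_ *+ _); apply: eq_card.
apply: ler_sum => p _; rewrite normrM normrX normrN1 expr1n mul1r.
rewrite normr_prod -bin2_sum big_mkord -prodrXr.
apply: ler_prod => i _; rewrite normr_ge0 !mxE normrX /=.
by rewrite lerXn2r ?nnegrE // (le_trans _ (zr (p i))).
Qed.

Lemma int_comb_integer (K : fieldExtType rat) (b : (\dim {:K}).-tuple K) v :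
  (forall i, algebraic_integer (tnth b i)) -> algebraic_integer (int_comb b v).
Proof.
move=> b_int; pose intK : {rmorphism int -> K} := intr.
apply: (big_ind (@algebraic_integer K)) => [|x y|i _].
- exact: (mxpoly.integral0 intK).
- exact: (@integral_add _ _ intK).
- rewrite -mulrzr; apply: (@integral_mul _ _ intK); first exact: b_int.
  exact: (integral_id intK).
Qed.

Lemma algebraic_integerB (K : fieldExtType rat) (x y : K) :
  algebraic_integer x -> algebraic_integer y -> algebraic_integer (x - y).
Proof. exact: (@integral_sub _ _ (intr : {rmorphism int -> K})). Qed.

(* 8 is the least [m] for which [m! (2/3)^(m choose 2) < 1]. *)
Lemma fact8_bound (R : realFieldType) : 8`!%:R * (2 / 3) ^+ 'C(8, 2) < 1 :> R.
Proof.
have h7 : (2 / 3 : R) ^+ 7 <= 1 / 17 by lra.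
have h28 : (2 / 3 : R) ^+ 28 <= (1 / 17) ^+ 4.
  by rewrite (exprM _ 7 4) lerXn2r ?nnegrE ?exprn_ge0 //; lra.
rewrite !factS fact0 !natrM (_ : 'C(8, 2) = 28)%N //; lra.
Qed.

Section LowerBound.
Variables (R : realType) (K : fieldExtType rat).
Let n := \dim {:K}.
Variable s : 'I_n -> {rmorphism K -> R[i]}.
Hypothesis s_sep : exists x, injective (fun j => s j x).
Hypothesis s_full : forall f : {rmorphism K -> R[i]}, exists j, f =1 s j.
Variable b : n.-tuple K.
Hypothesis b_int : forall i, algebraic_integer (tnth b i).
Let B := lattice_mx s b.
Hypothesis detB_neq0 : \det B != 0.

Lemma int_comb_inj : injective (int_comb b).
Proof.
move=> v w vw; have : map_mx intr v *m B = map_mx intr w *m B.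
  by apply/rowP => j; rewrite !lattice_mxE vw.
have B_unit : B \in unitmx by rewrite unitmxE unitfE.
move/(congr1 (fun M => M *m invmx B)); rewrite !mulmxK //.
by move=> /rowP vw'; apply/rowP => i; have := vw' i; rewrite !mxE => /intr_inj.
Qed.

Lemma det_lattice_mx_ge : (6 / 5) ^+ n <= 7 * `|\det B|.
Proof.
rewrite leNgt; apply/negP => ltB.
have n_gt0 : (0 < n)%N by apply: adim_gt0.
(* [k] is kept abstract, lest unification computes factorials. *)
have [k Dk] : exists k, k = 7%N by exists 7%N.
(* Scaling by 5/6 turns the assumption 7 |det B| < (6/5)^n into the volume condition; the half side
   5/9 given by [rho] = 10/9 becomes 2/3 after scaling back. *)
have [|||t [v [v_inj vt]]] := @real_lattice_pigeonhole R n k ((5 / 6) *: B) (10 / 9).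
- by rewrite detZ mulf_neq0 // expf_neq0 // mulf_neq0 ?invr_eq0 ?pnatr_eq0.
- rewrite Dk detZ normrM normrX [`|5 / 6|]ger0_norm ?divr_ge0 //.
  have -> : 5 / 6 = (6 / 5)^-1 :> R by field.
  by rewrite exprVn mulrCA mulrC ltr_pdivrMr ?mul1r // exprn_gt0 // divr_gt0.
- by rewrite ltr_pdivlMr // mul1r ltr_nat.
have [c cK cP] := conj_index_exists s_sep s_full.
pose z a j := s j (int_comb b (v a)).
pose t' j := (6 / 5) * t 0 j.
(* The real coordinates at [j] and at the conjugate index [c j] together locate the complex number
   [z a j]. *)
pose ctr j : R[i] := (((t' j + t' (c j)) / 2) +i* ((t' j - t' (c j)) / 2))%C.
have hz a j : `|hartley (z a j) - t' j| <= 2 / 3.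
  have := vt a j; rewrite -scalemxAr mxE lattice_mxE -/(z a j) !ler_norml /t'.
  by move=> /andP[h1 h2]; clear -h1 h2; apply/andP; split; lra.
have z_ctr j a : `|z a j - ctr j| <= (2 / 3)%:C%C.
  apply: norm_le_hartley; first exact: hz. by rewrite /z -cP; exact: hz.
pose q : R := k.+1`!%:R * (2 / 3) ^+ 'C(k.+1, 2).
pose V j := \prod_(a < k.+1) \prod_(a' < k.+1 | (a < a')%N) `|z a' j - z a j|.
have le_q j : V j <= q%:C%C.
  apply: le_trans (prod_dist_le (z_ctr j)) _.
  by rewrite [leRHS]rmorphM rmorphXn rmorph_nat.
have : \prod_j V j <= \prod_(j < n) q%:C%C.
  apply: ler_prod => j _; rewrite le_q andbT.
  by apply: prodr_ge0 => a _; apply: prodr_ge0.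
rewrite prodr_const card_ord -rmorphXn /V exchange_big /= => le_qn.
have q_lt1 : q ^+ n < 1.
  rewrite exprn_ilt1 -?lt0n // /q; last by rewrite Dk fact8_bound.
  by rewrite mulr_ge0 ?exprn_ge0 ?divr_ge0.
have : 1 <= (q ^+ n)%:C%C; last by rewrite -[1]/(1%:C)%C lecR leNgt q_lt1.
(* With the product over the embeddings innermost, each pair contributes the absolute norm of a
   nonzero integer of [K], which is at least 1. *)
apply: le_trans le_qn; under eq_bigr do rewrite exchange_big /=.
have mul_ge1 (x y : R[i]) : 1 <= x -> 1 <= y -> 1 <= x * y by apply: mulr_ege1.
apply: (big_ind (fun x : R[i] => 1 <= x)) => // a _.
apply: (big_ind (fun x : R[i] => 1 <= x)) => // a' aa'.
under eq_bigr do rewrite /z -rmorphB; rewrite -normr_prod.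
apply: norm_embeddings_ge1 => //.
  by apply: algebraic_integerB; apply: int_comb_integer.
rewrite subr_eq0; apply: contraTneq aa' => /int_comb_inj/v_inj ->.
by rewrite ltnn.
Qed.
End LowerBound.

(** * Hermite's theorem *)

(** One more linear factor raises a bound on all coefficients by a factor of at most 1 + M. *)
Lemma coef_prod_XsubC_le (C : numDomainType) (r : seq C) (M : C) i :
  {in r, forall z, `|z| <= M} -> 0 <= M ->
  `|(\prod_(z <- r) ('X - z%:P))`_i| <= (1 + M) ^+ size r.
Proof.
move=> rM M_ge0; elim: r rM i => [|z r IHr] rM i.
  by rewrite big_nil coef1 expr0 normr_nat lern1; case: (i == 0%N).
rewrite big_cons mulrBl coefB mul_polyC coefZ coefXM exprS.
have {}IHr k : `|(\prod_(z <- r) ('X - z%:P))`_k| <= (1 + M) ^+ size r.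
  by apply: IHr => w wr; apply: rM; rewrite inE wr orbT.
apply: le_trans (ler_normB _ _) _; rewrite mulrDl mul1r lerD //.
  by case: ifP => _; rewrite ?normr0 ?exprn_ge0 ?addr_ge0.
by rewrite normrM ler_pM // rM // inE eqxx.
Qed.

Lemma scaled_lt (R : realFieldType) (d e : R) :
  0 <= d -> 0 < e -> d * e < 4 * e * (d + 1).
Proof. by move=> d_ge0 e_gt0; have := mulr_ge0 d_ge0 (ltW e_gt0); lra. Qed.

Lemma le_half_of_mul4 (R : realFieldType) (h : R) : h * 4 <= 2 -> h <= 1 / 2.
Proof. lra. Qed.

Lemma half_le_mul2 (R : realFieldType) (h : R) : 1 <= h -> 1 / 2 <= 2 * h.
Proof. lra. Qed.

Section SmallGenerator.
Variables (R : realType) (K : fieldExtType rat).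
Let n := \dim {:K}.
Variable s : 'I_n -> {rmorphism K -> R[i]}.
Hypothesis s_sep : exists x, injective (fun j => s j x).
Hypothesis s_full : forall f : {rmorphism K -> R[i]}, exists j, f =1 s j.
Variable b : n.-tuple K.
Hypothesis b_int : forall i, algebraic_integer (tnth b i).
Let B := lattice_mx s b.
Hypothesis detB_neq0 : \det B != 0.
(** Length of the long side of the box: it offsets sides 1/4 in the other directions, so that the
    volume exceeds |det B|. *)
Let W : R := 4 ^+ n * (`|\det B| + 1).

Lemma small_separating_integer : exists (x : K) (j0 : 'I_n),
  [/\ algebraic_integer x, forall j, `|s j x| <= (2 * W)%:C%C
    & forall j, j != j0 -> s j x != s j0 x].
Proof.
have n_gt0 : (0 < n)%N by apply: adim_gt0.
pose j0 : 'I_n := Ordinal n_gt0.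
have W_ge1 : 1 <= W by rewrite mulr_ege1 ?exprn_ege1 ?lerDr // ler1n.
have W_gt0 : 0 < W by apply: lt_le_trans W_ge1.
(* Scaling the coordinates by [w] makes the long box a cube. With [rho] = 2 two points of that cube
   differ by at most 2 in each coordinate. *)
pose w : 'rV[R]_n := \row_j (if j == j0 then W^-1 else 4).
have det_w : \det (diag_mx w) = W^-1 * 4 ^+ n.-1.
  rewrite det_diag (bigD1 j0) //= mxE eqxx; congr (_ * _).
  rewrite (eq_bigr (fun=> 4)) => [|j /negPf jj0]; last by rewrite mxE jj0.
  rewrite prodr_const; congr (_ ^+ _).
  by have := cardC1 j0; rewrite card_ord.
have [|||t [v [v_inj vt]]] := @real_lattice_pigeonhole R n 1 (B *m diag_mx w) 2.
- rewrite det_mulmx det_w; apply: mulf_neq0 => //.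
  apply: mulf_neq0; first by rewrite invr_eq0 lt0r_neq0.
  by rewrite expf_neq0 // pnatr_eq0.
- rewrite mul1r det_mulmx det_w !normrM normfV normrX [`|W|]ger0_norm ?ltW //.
  rewrite mulrCA mulrC ltr_pdivrMr // mul1r /W -[in ltRHS](prednK n_gt0) exprS.
  by rewrite normr_nat scaled_lt // exprn_gt0.
- by rewrite ltr1n.
pose x := int_comb b (v ord0) - int_comb b (v ord_max).
have x_int : algebraic_integer x.
  by apply: algebraic_integerB; apply: int_comb_integer.
have x_neq0 : x != 0.
  rewrite subr_eq0; apply/eqP => /(int_comb_inj detB_neq0)/v_inj/(congr1 val).
  by [].
have [c cK cP] := conj_index_exists s_sep s_full.
have ux j : `|hartley (s j x) * w 0 j| <= 2.
  have := vt ord0 j; have := vt ord_max j.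
  rewrite !mulmxA !mul_mx_diag ![(\matrix_(_, _) _) 0 j]mxE !lattice_mxE.
  rewrite rmorphB raddfB mulrBl !ler_norml => /andP[h1 h2] /andP[h3 h4].
  by clear -h1 h2 h3 h4; apply/andP; split; lra.
have norm_le j r : `|hartley (s j x)| <= r -> `|hartley (s (c j) x)| <= r ->
    `|s j x| <= r%:C%C.
  move=> h1 h2; have := @norm_le_hartley R (s j x) 0 0 r.
  rewrite -cP !subr0 addr0 mul0r subr0; exact.
have u_small j : j != j0 -> `|hartley (s j x)| <= 1 / 2.
  move=> /negPf jj0; have := ux j; rewrite mxE jj0 normrM normr_nat.
  exact: le_half_of_mul4.
have u_big j : `|hartley (s j x)| <= 2 * W.
  have [->|/u_small] := eqVneq j j0; last first.
    by move=> h; apply: le_trans h (half_le_mul2 W_ge1).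
  have := ux j0; rewrite mxE eqxx normrM normfV [`|W|]gtr0_norm //.
  by rewrite ler_pdivrMr.
have z_small j : j != j0 -> j != c j0 -> `|s j x| <= (1 / 2)%:C%C.
  move=> jj0 jcj0; apply: norm_le; first exact: u_small.
  by apply: u_small; apply: contraNneq jcj0 => <-; rewrite cK.
have half_lt1 : (1 / 2)%:C%C < 1 :> R[i].
  by rewrite -[1 in ltRHS]/(1%:C%C) ltcR ltr_pdivrMr // mul1r ltr1n.
have z_conj : `|s (c j0) x| = `|s j0 x|.
  by rewrite cP; case: (s j0 x) => y z; rewrite !normc_def /= sqrrN.
(* Otherwise every conjugate would be less than 1 in absolute value: at [c j0] it has the same
   absolute value as at [j0], elsewhere at most 1/2. The norm would then be less than 1. *)
have z0_ge1 : 1 <= `|s j0 x|.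
  have := norm_embeddings_ge1 s_sep x_int x_neq0.
  apply: contraTT; rewrite -!real_ltNge ?real1 ?normr_real // => z0_lt1.
  rewrite normr_prod (bigD1 j0) //=; apply: (le_lt_trans _ z0_lt1).
  rewrite ler_piMr //.
  apply: prodr_ile1 => j jj0; rewrite normr_ge0 /=.
  have [->|jcj0] := eqVneq j (c j0); first by rewrite z_conj ltW.
  by rewrite (le_trans (z_small j jj0 jcj0)) // ltW.
exists x, j0; split=> // [j|j jj0]; first exact: norm_le.
apply: contraTneq z0_ge1 => zj.
suff z0_small : `|s j0 x| <= (1 / 2)%:C%C.
  by rewrite lt_geF // (le_lt_trans z0_small).
(* For [j = c j0] the equality makes [s j0 x] real, so its coordinate at [j0] equals the one at [j],
   which is short. *)
have [jcj0|jcj0] := eqVneq j (c j0); last by rewrite -zj z_small.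
by apply: norm_le; rewrite -?jcj0 -?zj u_small.
Qed.

Lemma small_generator : exists (x : K) (p : {poly int}),
  generates x (map_poly intr p) /\
  forall i, `|(p`_i)%R|%N%:R <= (1 + 2 * W) ^+ n.
Proof.
have [x [j0 [x_int x_le x_sep]]] := small_separating_integer.
have [p Dp] := char_poly_mult_mx_int x_int.
exists x, p; rewrite -Dp; split; first exact: generates_char_poly x_sep.
move=> i; rewrite -lecR.
have := char_poly_mult_mx s_sep x; rewrite Dp.
rewrite -(big_map (fun j => s j x) xpredT (fun z => 'X - z%:P)).
move/(congr1 (fun q : {poly R[i]} => `|q`_i|)).
rewrite coef_map /= coef_map /= ratr_int => Di.
rewrite rmorph_nat natr_absz intr_norm Di rmorphXn rmorphD rmorph1.
have Dn : size [seq s j x | j <- index_enum 'I_n] = n.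
  by rewrite size_map -[index_enum _]enumT size_enum_ord.
rewrite -[X in _ ^+ X]Dn; apply: coef_prod_XsubC_le.
  by move=> z /mapP[j _ ->].
by rewrite -[0]/(0%:C%C) lecR !mulr_ge0 ?exprn_ge0 ?addr_ge0.
Qed.
End SmallGenerator.

(** Without an integral basis [xget] would return the zero tuple, whose trace matrix has determinant
    0 since the degree is positive. *)
Lemma integral_basis_exists (K : fieldExtType rat) :
  discriminant K != 0 -> exists b : (\dim {:K}).-tuple K, integral_basis b.
Proof.
move=> D_neq0; apply: contrapT => /forallNP no_basis; move/eqP: D_neq0; apply.
rewrite /discriminant xgetPN //.
have -> : trace_matrix [tuple (0 : K) | i < \dim {:K}] = 0 *: 0.
  apply/matrixP => i j; rewrite !mxE tnth_mktuple mul0r mul0r.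
  by rewrite (raddf0 (@field_trace K)).
by rewrite detZ expr0n (gtn_eqF (adim_gt0 {:K}%AS)) mul0r.
Qed.

(** * Comparing the degree with the logarithm of the discriminant *)

(** Here [x] stands for log |D| and [m] for the degree. Since ln x is at most x^eps / eps, the first
    bound makes [m] at least of order x^(1 + beta), while the second makes it at most linear in [x];
    hence x^beta is bounded. *)
Lemma powR_ln_bound (R : realType) (n0 alpha kappa c : R) :
  0 < n0 -> 1 < alpha -> 0 < kappa -> 0 <= c ->
  exists2 X : R, 1 <= X & forall x m : R,
    n0^-1 * (x / ln x) `^ alpha <= m -> m * kappa <= c + x -> x <= X.
Proof.
move=> n0_gt0 alpha_gt1 kappa_gt0 c_ge0.
(* [eps] is chosen so that removing the logarithm costs half of the excess of [alpha] over 1; [beta]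
   is the half that remains. *)
pose eps := (alpha - 1) / (2 * alpha); pose beta := (alpha - 1) / 2.
have eps_gt0 : 0 < eps by rewrite divr_gt0 //; lra.
have beta_gt0 : 0 < beta by rewrite divr_gt0 //; lra.
have alpha_eps : (1 - eps) * alpha = 1 + beta.
  by rewrite /eps /beta; field; lra.
pose Q := (c + 1) / kappa * n0 / (eps `^ alpha).
have epsa_gt0 : 0 < eps `^ alpha by rewrite powR_gt0.
have Q_ge0 : 0 <= Q by rewrite !mulr_ge0 ?invr_ge0 ?ltW //; lra.
(* The summand 1 covers [x <= 1], where [ln x] is not positive. *)
exists (1 + Q `^ beta^-1) => [|x m xm mx]; first by rewrite lerDl powR_ge0.
have [x_le1|x_gt1] := leP x 1.
  by apply: le_trans x_le1 _; rewrite lerDl powR_ge0.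
have x_gt0 : 0 < x by lra.
have lnx_gt0 : 0 < ln x by rewrite ln_gt0.
have lnx_le : eps * ln x <= x `^ eps.
  rewrite -ln_powR; apply: le_trans (ltW (ln_sublinear _)) _; rewrite ?powR_gt0 //.
have x_ge0 : 0 <= x := ltW x_gt0.
have x_neq0 : x != 0 := lt0r_neq0 x_gt0.
have quot_ge : eps * x `^ (1 - eps) <= x / ln x.
  rewrite ler_pdivlMr // mulrAC powRB ?x_neq0 ?implybT // powRr1 //.
  by rewrite mulrA ler_pdivrMr ?powR_gt0 // mulrC ler_wpM2l.
have pow_ge : eps `^ alpha * (x * x `^ beta) <= (x / ln x) `^ alpha.
  rewrite -[X in X * _ `^ beta](powRr1 x_ge0) -powRD ?x_neq0 ?implybT // -alpha_eps.
  rewrite powRrM -powRM ?powR_ge0 //; last exact: ltW.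
  apply: ge0_ler_powR; rewrite ?nnegrE //; first by lra.
    by rewrite mulr_ge0 ?powR_ge0 // ltW.
  by rewrite divr_ge0 // ltW.
have m_le : m <= (c + 1) * x / kappa.
  rewrite ler_pdivlMr //; apply: le_trans mx _; rewrite mulrDl mul1r lerD2r.
  by rewrite ler_peMr // ltW.
have xb_le : x `^ beta <= Q.
  have : n0^-1 * (eps `^ alpha * (x * x `^ beta)) <= (c + 1) * x / kappa.
    apply: le_trans m_le; apply: le_trans xm.
    by rewrite ler_wpM2l // invr_ge0 ltW.
  rewrite ler_pdivlMr // -mulrA -ler_pdivlMl ?invr_gt0 // invrK => h.
  rewrite /Q ler_pdivlMr // -(ler_pM2l x_gt0).
  have -> : x * ((c + 1) / kappa * n0) = (c + 1) * x * n0 / kappa.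
    by field; apply: lt0r_neq0.
  rewrite ler_pdivlMr //; move: h; congr (_ <= _); ring.
have -> : x = (x `^ beta) `^ beta^-1 by rewrite -powRrM mulfV ?gt_eqF // powRr1.
apply: le_trans (ge0_ler_powR _ _ _ xb_le) _; rewrite ?nnegrE ?powR_ge0 //.
  by rewrite invr_ge0 ltW.
by rewrite lerDr.
Qed.

Lemma abs_det_lattice_mx (R : realType) (K : fieldExtType rat)
    (s : 'I_(\dim {:K}) -> {rmorphism K -> R[i]}) (b : (\dim {:K}).-tuple K) :
  (exists x, injective (fun j => s j x)) ->
  (forall f : {rmorphism K -> R[i]}, exists j, f =1 s j) ->
  integral_basis b ->
  `|\det (lattice_mx s b)| = Num.sqrt (ratr `|discriminant K|).
Proof.
move=> s_sep s_full b_basis; rewrite (discriminantE b_basis).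
by rewrite -(sqr_det_lattice_mx s_sep s_full) sqrtr_sqr.
Qed.

Section DiscriminantBounds.
Variables (R : realType) (K : fieldExtType rat).
Hypothesis D_neq0 : discriminant K != 0.
Let D : R := ratr `|discriminant K|.
Let n := \dim {:K}.

Let D_gt0 : 0 < D. Proof. by rewrite ltr0q normr_gt0. Qed.

Lemma dim_le_ln_discriminant : n%:R * (2 * ln (6 / 5)) <= 2 * ln 7 + ln D.
Proof.
have [b b_basis] := integral_basis_exists D_neq0.
have [s [s_sep s_full]] := embeddings_exist K R[i].
have := abs_det_lattice_mx s_sep s_full b_basis; rewrite -/D => DB.
have sqrtD_gt0 : 0 < Num.sqrt D by rewrite sqrtr_gt0.
have := @det_lattice_mx_ge R K s s_sep s_full b b_basis.1.
rewrite -normr_gt0 DB => /(_ sqrtD_gt0).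
move=> h.
have lnD : ln D = 2 * ln (Num.sqrt D).
  by rewrite -{1}(sqr_sqrtr (ltW D_gt0)) lnXn // mulr_natl.
have {}h : ln ((6 / 5) ^+ n) <= ln (7 * Num.sqrt D).
  by rewrite ler_ln // posrE ?exprn_gt0 ?mulr_gt0 ?divr_gt0.
have lnM7 : ln (7 * Num.sqrt D) = ln 7 + ln (Num.sqrt D).
  by apply: lnM; rewrite posrE.
move: h; rewrite lnXn ?divr_gt0 // lnM7 lnD -[_ *+ n]mulr_natl.
by rewrite mulrCA -mulrDr ler_pM2l.
Qed.

Lemma small_generator_exists : exists (x : K) (p : {poly int}),
  generates x (map_poly intr p) /\
  forall i, `|(p`_i)%R|%N%:R <= (1 + 2 * (4 ^+ n * (Num.sqrt D + 1))) ^+ n.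
Proof.
have [b b_basis] := integral_basis_exists D_neq0.
have [s [s_sep s_full]] := embeddings_exist K R[i].
have DB := abs_det_lattice_mx s_sep s_full b_basis.
have sqrtD_gt0 : 0 < Num.sqrt D by rewrite sqrtr_gt0.
rewrite -[Num.sqrt D]DB; apply: small_generator => //; first exact: b_basis.1.
by rewrite -normr_gt0 DB.
Qed.
End DiscriminantBounds.

(** * Finiteness and the final contradiction *)

Lemma int_poly_pigeonhole (p : nat -> {poly int}) (N H : nat) :
  (forall i, (size (p i) <= N)%N) -> (forall i k, (`|((p i)`_k)%R| <= H)%N) ->
  exists i j, i <> j /\ p i = p j.
Proof.
move=> p_size p_le.
pose T := {ffun 'I_N -> 'I_H.+1 * bool}.
(* As the coefficients are at most [H] in absolute value, [inord] loses nothing; the boolean keeps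
   the sign. *)
pose code i : T := [ffun k : 'I_N => (inord `|((p i)`_k)%R|%N, (p i)`_k < 0)].
have code_inj i j : code i = code j -> p i = p j.
  move=> cij; apply/polyP => k; have [ltkN|leNk] := ltnP k N; last first.
    by rewrite !nth_default // (leq_trans (p_size _)).
  have /ffunP/(_ (Ordinal ltkN)) := cij; rewrite !ffunE /= => -[+ sij].
  move=> /(congr1 val) /=; rewrite !inordK ?ltnS // => nij.
  rewrite [LHS]intEsign [RHS]intEsign sij.
  by congr (_ * Posz _).
apply: contrapT => no_pair.
suff /leq_card : injective (fun i : 'I_#|T|.+1 => code i).
  by rewrite card_ord ltnn.
move=> i j /code_inj pij; apply: contrapT => ij; apply: no_pair.
by exists i, j; split=> // /val_inj.
Qed.

(** Each field has a generator whose characteristic polynomial lies in one finite set, and a shared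
    polynomial makes two fields isomorphic. *)
Lemma hermite_pigeonhole (R : realType) (K : nat -> fieldExtType rat)
    (N : nat) (E : R) :
  (forall i, discriminant (K i) != 0) -> (forall i, \dim {:K i} <= N)%N ->
  (forall i, ratr `|discriminant (K i)| <= E) ->
  exists i j, i <> j /\ field_isomorphic (K i) (K j).
Proof.
move=> D_neq0 dim_le D_le.
(* This makes the bound of [small_generator_exists] uniform: it increases with the degree and the
   discriminant, so it is taken at [N] and [E]. *)
pose M : R := 1 + 2 * (4 ^+ N * (Num.sqrt E + 1)).
have M_ge0 : 0 <= M.
  by rewrite addr_ge0 // !mulr_ge0 ?exprn_ge0 ?addr_ge0 ?sqrtr_ge0.
have /choice[p pP] i : exists p : {poly int},
    [/\ exists x : K i, generates x (map_poly intr p), (size p <= N.+1)%N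
      & forall k, (`|(p`_k)%R| <= Num.truncn (M ^+ N))%N].
  have [x [p [xp p_le]]] := small_generator_exists R (D_neq0 i).
  exists p; split; first by exists x.
    have := generates_size xp; rewrite size_map_inj_poly //; last exact: intr_inj.
    by move=> ->; rewrite ltnS.
  move=> k; rewrite truncn_ge_nat ?exprn_ge0 //; apply: le_trans (p_le k) _.
  set M' := 1 + 2 * _; have M'_ge1 : 1 <= M' :> R.
    by rewrite lerDl !mulr_ge0 ?exprn_ge0 ?addr_ge0 ?sqrtr_ge0.
  apply: le_trans (ler_weXn2l M'_ge1 (dim_le i)) _.
  rewrite lerXn2r ?nnegrE ?(le_trans ler01 M'_ge1) // lerD2l ler_pM2l //.
  apply: ler_pM; rewrite ?exprn_ge0 ?addr_ge0 ?sqrtr_ge0 //.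
    by rewrite ler_weXn2l ?ler1n.
  by rewrite lerD2r ler_wsqrtr.
have [i|i|i [j [ij pij]]] := @int_poly_pigeonhole p N.+1 (Num.truncn (M ^+ N)).
- by have [] := pP i.
- by have [] := pP i.
exists i, j; split=> //.
have [[x xp] _ _] := pP i; have [[y yp] _ _] := pP j.
by apply: (generates_isomorphic xp); rewrite pij; exact: yp.
Qed.

Theorem proposition3p3 (R : realType) (n0 alpha : R)
    (hn0 : 1 < n0) (halpha : 1 < alpha) :
  ~ exists K : nat -> fieldExtType rat,
      (forall i j : nat, i <> j -> ~ field_isomorphic (K i) (K j)) /\
      (forall i : nat, 3 <= `|discriminant (K i)|) /\
      (forall i : nat,
         let logD : R := ln (ratr `|discriminant (K i)|) in
         n0^-1 * (logD / ln logD) `^ alpha <= (\dim {:K i})%:R /\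
         (\dim {:K i})%:R <= n0 * (logD / ln logD) `^ alpha).
Proof.
move=> [K [K_noniso [D_ge3 K_bounds]]].
have D_neq0 i : discriminant (K i) != 0.
  by rewrite -normr_gt0 (lt_le_trans _ (D_ge3 i)).
have kappa_gt0 : 0 < 2 * ln (6 / 5) :> R.
  by rewrite mulr_gt0 // ln_gt0 // ltr_pdivlMr // mul1r ltr_nat.
have ln7_ge0 : 0 <= 2 * ln 7 :> R by rewrite mulr_ge0 // ln_ge0 // ler1n.
(* The constants 2 ln (6/5) and 2 ln 7 are those of [dim_le_ln_discriminant]. *)
have [X _ XP] := powR_ln_bound (lt_trans ltr01 hn0) halpha kappa_gt0 ln7_ge0.
have lnD_le i : ln (ratr `|discriminant (K i)|) <= X.
  exact: XP (K_bounds i).1 (dim_le_ln_discriminant R (D_neq0 i)).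
have D_le i : ratr `|discriminant (K i)| <= expR X.
  rewrite -[leLHS]lnK ?ler_expR ?lnD_le // posrE ltr0q normr_gt0.
  exact: D_neq0.
(* With log |D| bounded, the same inequality now bounds the degree. *)
have dim_le i : (\dim {:K i} <= Num.truncn ((2 * ln 7 + X) / (2 * ln (6 / 5))))%N.
  have dim_le : (\dim {:K i})%:R <= (2 * ln 7 + X) / (2 * ln (6 / 5)).
    rewrite ler_pdivlMr //.
    apply: le_trans (dim_le_ln_discriminant R (D_neq0 i)) _.
    by rewrite lerD2l.
  by rewrite truncn_ge_nat // (le_trans _ dim_le).
have [i [j [ij Kij]]] := hermite_pigeonhole D_neq0 dim_le D_le.
exact: K_noniso ij Kij.
Qed.
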